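(* For integers $n\ge2$ and $0\le t\le n-2$, the number of $(102,001)$-avoiding inversion sequences $e$ of length $n$ with $\mathrm{rank}(e)=t$ is $2^{n-t-2}$.
   Context: An inversion sequence of length $n$ is an integer sequence $e=(e_1,\dots,e_n)$ with $0\le e_j\le j-1$ for all $j$. It contains a pattern $w=w_1w_2w_3$ if there are indices $i_1<i_2<i_3$ such that $e_{i_1}e_{i_2}e_{i_3}$ is order-isomorphic to $w$ (same relations $<,=,>$ between corresponding pairs of entries); otherwise it avoids $w$. ''$(w,w')$-avoiding'' means avoiding both $w$ and $w'$. $\max(e)$ is the largest entry, and $\mathrm{fdes}(e)$ is the position $p$ of the first descent: $e_1\le\cdots\le e_p>e_{p+1}$, with the convention $e_{n+1}=-1$. For a $102$-avoiding $e$, $\mathrm{rank}(e):=\mathrm{fdes}(e)-\max(e)-1$. *)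

(* Defs.v *)
From mathcomp Require Import all_boot all_order all_algebra.

Set Implicit Arguments.
Unset Strict Implicit.
Unset Printing Implicit Defensive.

Import Order.TTheory GRing.Theory Num.Theory.

(* Positions are 0-based: [e j] stands for the entry e_{j+1}, so that the
   condition e_{j+1} <= j reads [e j <= j]; it implies [e j < n], which is why
   the entries may be taken in ['I_n]. *)
Definition is_invseq n (e : {ffun 'I_n -> 'I_n}) : bool :=
  [forall j : 'I_n, e j <= j].

Definition order_isomorphic (u v : seq nat) : bool :=
  (size u == size v) &&
  [forall a : 'I_(size u), forall b : 'I_(size u),
     ((nth 0 u a < nth 0 u b) == (nth 0 v a < nth 0 v b)) &&
     ((nth 0 u a == nth 0 u b) == (nth 0 v a == nth 0 v b))].

Definition contains3 n (e : {ffun 'I_n -> 'I_n}) (w : seq nat) : bool :=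
  [exists i1 : 'I_n, exists i2 : 'I_n, exists i3 : 'I_n,
     [&& i1 < i2, i2 < i3 &
         order_isomorphic [:: (e i1 : nat); (e i2 : nat); (e i3 : nat)] w]].

Definition avoids3 n (e : {ffun 'I_n -> 'I_n}) (w : seq nat) : bool :=
  ~~ contains3 e w.

Definition max_entry n (e : {ffun 'I_n -> 'I_n}) : nat := \max_(i < n) e i.

(* The entry at 0-based position [k], extended by the convention e_{n+1} = -1;
   only the positions [k <= n] matter. *)
Definition entry n (e : {ffun 'I_n -> 'I_n}) (k : nat) : int :=
  if insub k is Some i then Posz (e i) else (-1)%R.

(* The 1-based position of the first descent; [find] returns its 0-based
   position, which exists for [n > 0] since the last position is a descent. *)
Definition fdes n (e : {ffun 'I_n -> 'I_n}) : nat :=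
  (find (fun k => (entry e k.+1 < entry e k)%R) (iota 0 n)).+1.

(* Integer-valued, so that no subtraction is truncated. *)
Definition rank n (e : {ffun 'I_n -> 'I_n}) : int :=
  (Posz (fdes e) - Posz (max_entry e) - 1)%R.

(* Main.v *)
Require Import Defs.
From mathcomp Require Import all_boot all_order all_algebra.
From mathcomp Require Import zify.

(** Let [m] be the maximum of such a sequence and [t] its rank.  Avoiding [001]
    makes the initial weakly increasing run climb strictly until its last
    value, so that [e_j <= j - 1] forces it to be [0, 1, ..., m, m, ..., m] with
    [t] extra copies of [m]; avoiding [102] shows that its last value is indeed
    the maximum.  Every later entry then repeats an earlier value, so the rest
    of the sequence is a weakly decreasing word of length [n - 1 - t - m] with
    letters below [m].  There are ['C(n - t - 2, m - 1)] such words, and summing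
    over [m] gives [2 ^ (n - t - 2)]. *)

Set Implicit Arguments.
Unset Strict Implicit.
Unset Printing Implicit Defensive.

(** * Patterns of length three as inequalities *)

Lemma order_isomorphic3P (a b c x y z : nat) :
  reflect [/\ [/\ (a < b) = (x < y), (a == b) = (x == y) & (b < a) = (y < x)],
              [/\ (a < c) = (x < z), (a == c) = (x == z) & (c < a) = (z < x)]
            & [/\ (b < c) = (y < z), (b == c) = (y == z) & (c < b) = (z < y)]]
          (order_isomorphic [:: a; b; c] [:: x; y; z]).
Proof.
rewrite /order_isomorphic /=; apply: (iffP forallP)
  => [H | [[? ? ?] [? ? ?] [? ? ?]]].
  have {}H (i j : 'I_3) := andP (forallP (H i) j).
  pose i0 : 'I_3 := @Ordinal 3 0 isT.
  pose i1 : 'I_3 := @Ordinal 3 1 isT.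
  pose i2 : 'I_3 := @Ordinal 3 2 isT.
  have [/eqP ? /eqP ?] := H i0 i1; have [/eqP ? _] := H i1 i0.
  have [/eqP ? /eqP ?] := H i0 i2; have [/eqP ? _] := H i2 i0.
  by have [/eqP ? /eqP ?] := H i1 i2; have [/eqP ? _] := H i2 i1.
case=> [[|[|[|//]]] ?] /=; apply/forallP; case=> [[|[|[|//]]] ?] /=;
  apply/andP; split; apply/eqP => //; rewrite ?eqxx ?ltnn // eq_sym //;
  by rewrite [RHS]eq_sym.
Qed.

Lemma order_isomorphic_102 (a b c : nat) :
  order_isomorphic [:: a; b; c] [:: 1; 0; 2] = (b < a < c).
Proof.
apply/order_isomorphic3P/idP => [[[? ? ?] [? ? ?] [? ? ?]]|H]; first by lia.
by do 2!split; lia.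
Qed.

Lemma order_isomorphic_001 (a b c : nat) :
  order_isomorphic [:: a; b; c] [:: 0; 0; 1] = (a == b) && (b < c).
Proof.
apply/order_isomorphic3P/idP => [[[? ? ?] [? ? ?] [? ? ?]]|H]; first by lia.
by do 2!split; lia.
Qed.

Lemma find_iota0 (P : pred nat) (n k : nat) : k < n -> P k ->
  (forall j, j < k -> ~~ P j) -> find P (iota 0 n) = k.
Proof.
move=> kn Pk nP.
have hasP : has P (iota 0 n) by apply/hasP; exists k; rewrite // mem_iota.
have fn : find P (iota 0 n) < n by rewrite -[X in _ < X](size_iota 0) -has_find.
case: (ltngtP (find P (iota 0 n)) k) => // [lt|gt].
  by have := nth_find 0 hasP; rewrite nth_iota // (negbTE (nP _ lt)).
by have := before_find 0 gt; rewrite nth_iota // Pk.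
Qed.

(** * Entries and first descent at natural-number positions *)

Section Structure.

Variable n : nat.
Implicit Types e : {ffun 'I_n.+1 -> 'I_n.+1}.

(** Natural-number indices leave position arithmetic to [lia]; past [n], [inord] falls back to
    position 0, so statements are restricted to [k <= n]. *)
Definition val_at e (k : nat) : nat := e (inord k).

Lemma val_atE e (i : 'I_n.+1) : val_at e i = e i.
Proof. by rewrite /val_at inord_val. Qed.

Lemma entryE e k : k <= n -> entry e k = Posz (val_at e k).
Proof.
move=> kn; rewrite /entry insubT /val_at; do 3!f_equal.
by apply: val_inj; rewrite /= inordK.
Qed.

Lemma entry_end e : entry e n.+1 = (-1)%R.
Proof. by rewrite /entry insubF // ltnn. Qed.

Lemma invseqP e :
  reflect (forall k, k <= n -> val_at e k <= k) (is_invseq e).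
Proof.
apply: (iffP forallP) => H k; last by rewrite -val_atE H // -ltnS.
by move=> kn; have := H (inord k); rewrite inordK.
Qed.

Lemma avoids3P e (w : seq nat) :
  reflect (forall i j k, i < j < k -> k <= n ->
             ~~ order_isomorphic [:: val_at e i; val_at e j; val_at e k] w)
          (avoids3 e w).
Proof.
apply: (iffP idP) => [av i j k ijk kn | H].
  apply: contra av => iso; apply/existsP; exists (inord i).
  apply/existsP; exists (inord j); apply/existsP; exists (inord k).
  by rewrite -/(val_at e i) iso !inordK; lia.
apply/existsP => -[i /existsP[j /existsP[k /and3P[ij jk iso]]]].
by have := H i j k; rewrite !val_atE iso ij jk -ltnS ltn_ord => /(_ isT isT).
Qed.

Lemma fdes_bounds e : exists2 p, fdes e = p.+1 &
  [/\ p <= n, forall k, k < p -> val_at e k <= val_at e k.+1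
    & p < n -> val_at e p.+1 < val_at e p].
Proof.
pose P k := (entry e k.+1 < entry e k)%R.
pose p := find P (iota 0 n.+1); exists p => //.
have hasP : has P (iota 0 n.+1).
  by apply/hasP; exists n; rewrite ?mem_iota //= /P entry_end entryE.
have pn : p < n.+1 by rewrite -[X in _ < X](size_iota 0 n.+1) -has_find.
split=> // [k kp | lt_pn].
  have := before_find 0 kp; rewrite nth_iota ?(ltn_trans kp) // add0n /P.
  by rewrite !entryE; lia.
have := nth_find 0 hasP; rewrite -/p nth_iota // add0n /P !entryE //.
Qed.

(* [m] is the maximum and [t] the rank; positions are 0-based, so the initial
   run occupies the positions up to [m + t]. *)
Definition shape t m e : Prop :=
  [/\ m + t <= n,
      forall k, k <= m + t -> val_at e k = minn k m,
      forall k, m + t < k <= n -> val_at e k < m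
    & forall j k, m + t < j -> j < k <= n -> val_at e k <= val_at e j].

Lemma max_entry_le e k : val_at e k <= max_entry e.
Proof. exact: (leq_bigmax (F := fun i => nat_of_ord (e i))). Qed.

Lemma shape_of_avoiding t e : is_invseq e -> avoids3 e [:: 1; 0; 2] ->
  avoids3 e [:: 0; 0; 1] -> rank e = Posz t -> shape t (max_entry e) e.
Proof.
move=> /invseqP inv /avoids3P av102 /avoids3P av001.
rewrite /rank; have [p -> [pn up down]] := fdes_bounds e => rk.
set M := val_at e p.
have mono k : k <= p -> val_at e k <= M.
  move=> kp; rewrite /M -(subnKC kp).
  move: (p - k) (subnKC kp) => d; elim: d k {kp} => [|d IH] k kd.
    by rewrite addn0.
  by rewrite addnS -addSn (leq_trans _ (IH k.+1 _)) ?up //; lia.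
(* Equal neighbours below [M] would form 001 with position [p], so the run climbs at every step
   until it reaches [M]; the bound [val_at e k <= k] keeps each climb to exactly one. *)
have run k : k <= p -> val_at e k = minn k M.
  elim: k => [|k IH] kp; first by have := inv 0; lia.
  have := IH (ltnW kp); have := up k kp; have := mono _ kp.
  have := inv k.+1 (leq_trans kp pn).
  have [->|neq] := eqVneq k.+1 p; first by rewrite -/M; lia.
  by have := av001 k k.+1 p; rewrite order_isomorphic_001 -/M; lia.
(* A later value above [M] would complete the descent at [p], [p.+1] to a 102. *)
have after k : p < k <= n -> val_at e k <= M.
  move=> /andP[pk kn]; have := down (leq_trans pk kn).
  have [->|neq] := eqVneq k p.+1; first by rewrite -/M; lia.
  by have := av102 p p.+1 k; rewrite order_isomorphic_102 -/M; lia.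
have maxE : max_entry e = M.
  apply/eqP; rewrite eqn_leq max_entry_le andbT; apply/bigmax_leqP => i _.
  rewrite -val_atE; case: (leqP i p) => [/mono //|pi].
  by rewrite after // pi -ltnS ltn_ord.
have Mp : M <= p by apply: inv.
have pE : p = M + t by rewrite maxE in rk; lia.
(* The value at [j] already occurs at position [val_at e j], inside the run. *)
have decr j k : p < j -> j < k <= n -> val_at e k <= val_at e j.
  move=> pj /andP[jk kn].
  have vM : val_at e j <= M by apply: after; lia.
  have := run (val_at e j); have := av001 (val_at e j) j k.
  by rewrite order_isomorphic_001; lia.
rewrite maxE; split; rewrite -?pE // => k /andP[pk kn].
have [->|neq] := eqVneq k p.+1; first by apply: down; lia.
by apply: leq_ltn_trans (decr p.+1 k _ _) (down _); lia.
Qed.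

(** A drop must end in the tail, after which nothing rises: no 102. In a repetition, either the
    second entry lies in the tail or both equal the maximum [m], so nothing larger follows: no
    001. *)
Lemma shape_avoiding t m e : shape t m e ->
  [/\ is_invseq e, avoids3 e [:: 1; 0; 2], avoids3 e [:: 0; 0; 1],
      rank e = Posz t & max_entry e = m].
Proof.
move=> [mtn run small decr].
have maxE : max_entry e = m.
  apply/eqP; rewrite eqn_leq; apply/andP; split.
    apply/bigmax_leqP => i _; rewrite -val_atE.
    have := run i; have := small i; have := ltn_ord i; lia.
  by rewrite -[X in X <= _](_ : val_at e m = m) ?max_entry_le // run; lia.
have fdesE : fdes e = (m + t).+1.
  congr _.+1; apply: find_iota0 => [//||j jmt].
    rewrite [X in (_ < X)%R]entryE // run //.
    (* With an empty tail the descent comes from the convention -1. *)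
    have [->|neq] := eqVneq (m + t) n; first by rewrite entry_end.
    by rewrite entryE; [have := small (m + t).+1|]; lia.
  by rewrite !entryE ?run; lia.
split=> //; last by rewrite /rank fdesE maxE; lia.
- by apply/invseqP => k kn; have := run k; have := small k; lia.
- apply/avoids3P => i j k ijk kn; rewrite order_isomorphic_102.
  have := run i; have := run j; have := run k.
  have := small i; have := small j; have := small k; have := decr j k; lia.
- apply/avoids3P => i j k ijk kn; rewrite order_isomorphic_001.
  have := run i; have := run j; have := run k.
  have := small i; have := small j; have := small k; have := decr j k; lia.
Qed.

(* The decreasing tail is read backwards, from the last position, to match the
   increasing tuples counted by [card_sorted_tuples]. *)
Definition of_tail t m q (s : q.-tuple 'I_m.+1) : {ffun 'I_n.+1 -> 'I_n.+1} :=
  [ffun j : 'I_n.+1 => inord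
     (if j <= m.+1 + t then minn j m.+1 else nth 0 (map val s) (n - j))].

Lemma of_tailE t m q (s : q.-tuple 'I_m.+1) k : m.+1 + t <= n -> k <= n ->
  val_at (of_tail t s) k =
    if k <= m.+1 + t then minn k m.+1 else nth 0 (map val s) (n - k).
Proof.
move=> mtn kn; rewrite /val_at ffunE (inordK (m := k)) // inordK //.
case: ifP => _; first by lia.
(* Both the default 0 of [nth] and the letters, at most [m], stay within the range of [inord]. *)
case: (ltnP (n - k) q) => kq; last by rewrite nth_default // size_map size_tuple.
by rewrite (nth_map ord0) ?size_tuple // (leq_trans (ltn_ord _)) //; lia.
Qed.

Lemma shape_of_tail t m q (s : q.-tuple 'I_m.+1) : m.+1 + t + q = n ->
  sorted leq (map val s) -> shape t m.+1 (of_tail t s).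
Proof.
move=> nE srt; have mtn : m.+1 + t <= n by lia.
split=> // [k kmt | k /andP[mtk kn] | j k mtj /andP[jk kn]].
- by rewrite of_tailE ?kmt //; lia.
- rewrite of_tailE // ifF; last by lia.
  rewrite (nth_map ord0) ?size_tuple ?ltn_ord //; lia.
rewrite !of_tailE ?ifF; try lia.
by apply: (sorted_leq_nth leq_trans leqnn _ srt);
  rewrite ?inE ?size_map ?size_tuple; lia.
Qed.

Lemma of_tail_inj t m q : m.+1 + t + q = n -> injective (@of_tail t m q).
Proof.
move=> nE s1 s2 eq12; apply: val_inj; apply: (inj_map val_inj).
apply: (@eq_from_nth _ 0) => [|i]; first by rewrite !size_map !size_tuple.
rewrite size_map size_tuple => iq.
have := congr1 (val_at^~ (n - i)) eq12; rewrite /= !of_tailE; try lia.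
by rewrite !ifF ?subKn //; lia.
Qed.

Lemma shape_tail t m q e : m.+1 + t + q = n -> shape t m.+1 e ->
  exists2 s : q.-tuple 'I_m.+1, sorted leq (map val s) & e = of_tail t s.
Proof.
move=> nE [mtn run small decr].
pose s := [tuple inord (val_at e (n - i)) : 'I_m.+1 | i < q].
have sE i : i < q -> nth 0 (map val s) i = val_at e (n - i).
  move=> iq; rewrite (nth_map ord0) ?size_tuple // -[i]/(val (Ordinal iq)).
  by rewrite -tnth_nth tnth_mktuple /= inordK // small //; lia.
exists s.
  apply/(sortedP 0) => i; rewrite size_map size_tuple => iq.
  by rewrite !sE ?(ltnW iq) //; apply: decr; lia.
apply/ffunP => j; apply: val_inj; rewrite /= -!val_atE.
have jn := ltn_ord j; rewrite of_tailE //.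
case: leqP => mtj; first exact: run.
by rewrite sE ?subKn //; lia.
Qed.

(** Rank and maximum determine the run, leaving only the tail free: a multiset of [q] letters from
    [m.+1], counted by 'C(m + q, q) = 'C(m + q, m). *)
Lemma card_avoiding_max t m q : m.+1 + t + q = n ->
  #|[set e : {ffun 'I_n.+1 -> 'I_n.+1} |
      [&& is_invseq e, avoids3 e [:: 1; 0; 2], avoids3 e [:: 0; 0; 1]
        & rank e == Posz t] && (max_entry e == m.+1)]| = 'C(m + q, m).
Proof.
move=> nE; transitivity
  #|@of_tail t m q @: [set s : q.-tuple 'I_m.+1 | sorted leq (map val s)]|.
  congr #|pred_of_set _|; apply/setP => e; rewrite inE.
  apply/andP/imsetP => [[/and4P[inv av av' /eqP rk] /eqP maxE] | [s]].
    have := shape_of_avoiding inv av av' rk; rewrite maxE => /(shape_tail nE).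
    by case=> s srt ->; exists s; rewrite ?inE.
  rewrite inE => /(shape_of_tail nE)/shape_avoiding[inv av av' rk maxE] ->.
  by rewrite inv av av' rk maxE !eqxx.
rewrite card_imset; last exact: of_tail_inj.
by rewrite card_sorted_tuples addnC -[in RHS]bin_sub ?leq_addr // addKn.
Qed.

End Structure.

Theorem proposition5p2 (n t : nat) (hn : 2 <= n) (ht : t <= n - 2) :
  #|[set e : {ffun 'I_n -> 'I_n} |
      [&& is_invseq e, avoids3 e [:: 1; 0; 2], avoids3 e [:: 0; 0; 1]
        & rank e == Posz t]]| = 2 ^ (n - t - 2).
Proof.
case: n hn ht => [//|n] hn ht.
have -> : n.+1 - t - 2 = n - t - 1 by lia.
set A := [set e | _].
(* A maximum 0 leaves no letter for a tail, so the run would fill the sequence and the rank would be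
   [n], against [ht]. *)
have maxA e : e \in A -> 0 < max_entry e <= n - t.
  rewrite inE => /and4P[inv av av' /eqP rk].
  have [mtn _ small _] := shape_of_avoiding inv av av' rk.
  have := small n; lia.
have -> : #|A| = \sum_(m < (n - t - 1).+1) 'C(n - t - 1, m); last first.
  by rewrite (expnDn 1 1); apply: eq_bigr => i _; rewrite !exp1n !muln1.
rewrite -sum1_card.
(* Classes are indexed by the maximum minus one; by [maxA], [inord] does not alter this index on
   [A]. *)
rewrite (partition_big
  (fun e => inord (max_entry e).-1 : 'I_(n - t - 1).+1) predT) //=.
apply: eq_bigr => m _; have mlt := ltn_ord m.
have nE : m.+1 + t + (n - t - 1 - m) = n by lia.
have -> : 'C(n - t - 1, m) = 'C(m + (n - t - 1 - m), m) by congr binomial; lia.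
rewrite -(card_avoiding_max nE) sum1_card; apply: eq_card => e.
rewrite !inE [in LHS]unfold_in.
case: (boolP (e \in A)) => [eA|]; last by rewrite inE => /negbTE ->.
move: (eA); rewrite inE => -> /=.
have := maxA e eA; rewrite -val_eqE /= => bnd.
by rewrite inordK; lia.
Qed.
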